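(* Let $\rho:\Gamma\to G$ be a $(P^+,P^-)$-Anosov representation whose domain of discontinuity $M:=\Omega_\rho$ is a complex curve (complex manifold with $\dim_{\mathbb{C}}M=1$) on which $\rho(\Gamma)$ acts by biholomorphisms. For $g\in\rho(\Gamma)$ let $\mathcal{E}^g=g^*T^{1,0}M$ and let $\mathcal{A}ut(\mathcal{E}^g)$ be its group of gauge automorphisms. Then the action of $\Gamma$ via $\rho$ is properly discontinuous on $$\coprod_{g\in\rho(\Gamma)}\{\text{Higgs bundle structures on }\mathcal{E}^g\}\big/\mathcal{A}ut(\mathcal{E}^g).$$
   Context: Anosov representations. $\Gamma$ is a finitely generated word hyperbolic group with boundary $\partial_\infty\Gamma$, and $\partial_\infty\Gamma^{(2)}=\partial_\infty\Gamma\times\partial_\infty\Gamma\setminus\{(t,t)\}$. $G$ is a semisimple Lie group, $(P^+,P^-)$ a pair of opposite parabolic subgroups, $\mathcal{F}^\pm=G/P^\pm$. A pair in $\mathcal{F}^+\times\mathcal{F}^-$ is transverse if it lies in the unique open $G$-orbit of the diagonal action (this orbit is $\cong G/(P^+\cap P^-)$). $\hat\Gamma$ is the (essentially unique) proper hyperbolic metric space with an action of $\Gamma\times(\mathbb{R}\rtimes\mathbb{Z}/2\mathbb{Z})$ such that $\Gamma\times\mathbb{Z}/2\mathbb{Z}$ acts isometrically, every orbit map $\Gamma\to\hat\Gamma$ is a quasi-isometry, the $\mathbb{R}$-action $\phi_t$ is free with quasi-isometrically embedded orbits, and the induced map $(\tau^+,\tau^-):\hat\Gamma/\mathbb{R}\to\partial_\infty\Gamma^{(2)}$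 (endpoints of orbits) is a homeomorphism. A representation $\rho:\Gamma\to G$ is $(P^+,P^-)$-Anosov if there are continuous $\rho$-equivariant maps $\xi^\pm:\partial_\infty\Gamma\to\mathcal{F}^\pm$ such that (1) $(\xi^+(t^+),\xi^-(t^-))$ is transverse for all $(t^+,t^-)\in\partial_\infty\Gamma^{(2)}$; (2) for one (hence any) continuous equivariant family of norms $\|\cdot\|_{\hat m}$, $\hat m\in\hat\Gamma$, on $T_{\xi^+(\tau^+(\hat m))}\mathcal{F}^+$ (resp. $T_{\xi^-(\tau^-(\hat m))}\mathcal{F}^-$) there are $A,a>0$ with $\|e\|_{\phi_{-t}(\hat m)}\le Ae^{-at}\|e\|_{\hat m}$ (resp. $\|e\|_{\phi_t(\hat m)}\le Ae^{-at}\|e\|_{\hat m}$) for all $t\ge0$, $\hat m$, $e$. Domain of discontinuity. $\mathcal{X}=G/H$ with $H$ a parabolic or a symmetric subgroup of $G$. $M=\Omega_\rho\subset\mathcal{X}$ is a domain of discontinuity for $\rho$: an open $\rho(\Gamma)$-invariant subset such that for every compact $K\subset\Omega_\rho$ the set $\{\gamma\in\Gamma:\rho(\gamma)K\cap K\ne\emptyset\}$ is finite. An action of $\rho(\Gamma)$ on a topological space $X$ is called properly discontinuous if for every compact (not necessarily Hausdorff) $K\subset X$ the set $\{\gamma\in\Gamma:\rho(\gamma)K\cap K\neq\emptyset\}$ is finite. Bundles and actions. $T^{1,0}M$ is the $(1,0)$-part of $TM\otimes_{\mathbb{R}}\mathbb{C}$, and $\mathcal{E}^g=\{(m,x)\in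 M\times T^{1,0}M: x\in T^{1,0}M|_{gm}\}$, $\mathcal{E}=\mathcal{E}^{e}=T^{1,0}M$. For $g,g'\in\rho(\Gamma)$ there is a holomorphic bundle isomorphism $g:\mathcal{E}^{g'}\to\mathcal{E}^{gg'}$ over $\mathrm{id}_M$, given over $m$ by the restriction of $dg|_{g'm}\otimes\mathrm{id}$ to $T^{1,0}M|_{g'm}\to T^{1,0}M|_{gg'm}$; it induces $g:\mathrm{End}(\mathcal{E}^{g'})\to\mathrm{End}(\mathcal{E}^{gg'})$ by conjugation and acts on $\mathrm{End}$-valued forms by $(g\varphi)(m)=(\mathrm{id}\otimes g)(\varphi(m))$. A pseudo-connection on a complex vector bundle $\mathbb{E}$ is a $\mathbb{C}$-linear operator $D:\Omega^0(M;\mathbb{E})\to\Omega^{0,1}(M;\mathbb{E})$ with $D(fs)=\bar\partial f\otimes s+fDs$ (extended to $\mathbb{E}$-valued forms by the Leibniz rule; $D^{\mathrm{End}(\mathbb{E})}$ is the induced pseudo-connection on $\mathrm{End}(\mathbb{E})$). For a pseudo-connection $D$ on $\mathcal{E}^{g'}$, $gD:=g\circ D\circ g^{-1}$ is a pseudo-connection on $\mathcal{E}^{gg'}$. $\mathfrak{D}^{\mathcal{E}^g}$ is the space of pseudo-connections on $\mathcal{E}^g$. A Higgs bundle structure on $\mathbb{E}$ is a pair $(D,\phi)$ with $D$ a pseudo-connection on $\mathbb{E}$ and $\phi\in\Omega^{1,0}(M;\mathrm{End}(\mathbb{E}))$ such that $D^2=0$, $D^{\mathrm{End}(\mathbb{E})}\phi=0$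 and $\phi\wedge\phi=0$. $\rho(\Gamma)$ acts on $\coprod_g\{\text{Higgs bundle structures on }\mathcal{E}^g\}$ by $g(D,\phi)=(gD,g\phi)$. Gauge automorphisms are smooth complex vector bundle automorphisms $\tau$ covering $\mathrm{id}_M$, acting by $\tau\cdot(D,\phi)=(\tau D\tau^{-1},\tau\phi\tau^{-1})$; the action of $\rho(\Gamma)$ descends to the quotient since $g\tau g^{-1}\in\mathcal{A}ut(\mathcal{E}^{gg'})$ for $\tau\in\mathcal{A}ut(\mathcal{E}^{g'})$. Topology. $\Omega^{p,q}(M;\mathrm{End}(\mathcal{E}^g))$ has the topology of pointwise convergence, i.e. the subspace topology from $\prod_{m\in M}\bigl(\bigwedge^pT^{*1,0}M\otimes\bigwedge^qT^{*0,1}M\otimes\mathrm{End}(\mathcal{E}^g)\bigr)$ (copies of the total space of the bundle). Fix a pseudo-connection $D_0$ on $\mathcal{E}$; $\mathfrak{D}^{\mathcal{E}^g}$ is topologized so that $\Omega^{0,1}(M;\mathrm{End}(\mathcal{E}^g))\to\mathfrak{D}^{\mathcal{E}^g}$, $A\mapsto gD_0+A$, is a homeomorphism. The set of Higgs bundle structures on $\mathcal{E}^g$ has the subspace topology from $\mathfrak{D}^{\mathcal{E}^g}\times\Omega^{1,0}(M;\mathrm{End}(\mathcal{E}^g))$, its quotient by $\mathcal{A}ut(\mathcal{E}^g)$ the quotient topology, and the coproduct the disjoint union topology. *)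

(* Defs.v *)
From HB Require Import structures.
From mathcomp Require Import all_boot all_order all_algebra.
From mathcomp Require Import complex.
From mathcomp Require Import all_classical all_reals all_analysis.
Import numFieldNormedType.Exports.
Set Implicit Arguments.
Unset Strict Implicit.
Unset Printing Implicit Defensive.
Import Order.TTheory GRing.Theory Num.Theory.
Local Open Scope classical_set_scope.
Local Open Scope ring_scope.
Local Open Scope quotient_scope.

(* For U open, C^(k+1) is expressed by: all directional derivatives exist on U
   and are C^k there. Only the values of f on U matter. *)
Fixpoint Ck_on (R : realType) (n k : nat) (U : set 'rV[R]_n)
    (f : 'rV[R]_n -> R^o) : Prop :=
  (forall x, U x -> continuous_at x f) /\
  (if k is k'.+1 then
     forall v, (forall x, U x -> derivable f x v) /\
               Ck_on k' U (fun x => 'D_v f x)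
   else True).

Definition smooth_on (R : realType) (n : nat) (U : set 'rV[R]_n)
    (f : 'rV[R]_n -> R^o) : Prop := forall k, Ck_on k U f.

Record chart (R : realType) (T : topologicalType) (n : nat) := Chart {
  cdom : set T;
  cfun :> T -> 'rV[R]_n;
  cinv : 'rV[R]_n -> T;
  cdom_open : open cdom;
  cimg_open : open (cfun @` cdom);
  cfunK : forall x, cdom x -> cinv (cfun x) = x;
  cfun_cont : forall x, cdom x -> continuous_at x cfun;
  cinv_cont : forall y, (cfun @` cdom) y -> continuous_at y cinv }.

(* A smooth structure, presented by its smooth real functions on open sets;
   [fs U f] is only meant for U open and only depends on the values on U. *)
Record fun_structure (R : realType) (T : topologicalType) := FunStructure {
  fs :> set T -> (T -> R^o) -> Prop;
  fsD : forall U f g, open U -> fs U f -> fs U g -> fs U (fun x => f x + g x) }.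

Section CkAdd.
Variables (R : realType) (n : nat).
Implicit Types (U : set 'rV[R]_n) (f g : 'rV[R]_n -> R^o).

Lemma Ck_on_ext k U f g :
  open U -> (forall x, U x -> f x = g x) -> Ck_on k U f -> Ck_on k U g.
Proof.
move=> oU; elim: k f g => [|k IH] f g fg [cf df].
  split=> // x Ux; rewrite /continuous_at -(fg _ Ux).
  apply: cvg_trans (cf _ Ux); apply: (@near_eq_cvg _ _ (nbhs x)).
  by apply: (@filterS _ (nbhs x) _ U); [move=> y /fg ->|exact: open_nbhs_nbhs].
have near_fg x : U x -> \forall y \near x, f y = g y.
  move=> Ux.
  by apply: (@filterS _ (nbhs x) _ U); [move=> y /fg ->|exact: open_nbhs_nbhs].
split=> [x Ux|v].
  rewrite /continuous_at -(fg _ Ux).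
  apply: cvg_trans (cf _ Ux); apply: (@near_eq_cvg _ _ (nbhs x)).
  by apply: (@filterS _ (nbhs x) _ U); [move=> y /fg ->|exact: open_nbhs_nbhs].
have [dfv Cv] := df v; split.
  by move=> x Ux; exact: near_eq_derivable (near_fg _ Ux) (dfv _ Ux).
by apply: IH Cv => x Ux; apply: near_eq_derive; exact: near_fg.
Qed.

Lemma Ck_onD k U f g :
  open U -> Ck_on k U f -> Ck_on k U g -> Ck_on k U (fun x => f x + g x).
Proof.
move=> oU; elim: k f g => [|k IH] f g [cf df] [cg dg];
  (have cfg x : U x -> continuous_at x (fun x => f x + g x)
     by move=> Ux; exact: continuousD (cf _ Ux) (cg _ Ux));
  split=> // v.
have [dfv Cf] := df v; have [dgv Cg] := dg v; split.
  by move=> x Ux; apply: derivableD; [exact: dfv|exact: dgv].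
apply: Ck_on_ext (IH _ _ Cf Cg) => // x Ux.
by rewrite deriveD //; [exact: dfv|exact: dgv].
Qed.

Lemma smooth_onD U f g :
  open U -> smooth_on U f -> smooth_on U g -> smooth_on U (fun x => f x + g x).
Proof. by move=> oU sf sg k; apply: Ck_onD. Qed.

End CkAdd.

Section Atlas.
Variables (R : realType) (T : topologicalType) (n : nat).

Definition smooth_atlas (A : set (chart R T n)) : Prop :=
  (forall x, exists2 c, A c & cdom c x) /\
  (forall c c' j, A c -> A c' ->
     smooth_on (c @` (cdom c `&` cdom c')) (fun v => c' (cinv c v) 0 j)).

Lemma chart_img_open (c : chart R T n) (U : set T) :
  open U -> open (c @` (U `&` cdom c)).
Proof.
move=> oU.
have -> : c @` (U `&` cdom c) = (c @` cdom c) `&` (cinv c @^-1` (U `&` cdom c)).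
  apply/seteqP; split=> [_ [x [Ux dx] <-]|_ [[x dx <-]]] /=.
    by split; [exists x|rewrite cfunK].
  by rewrite cfunK // => -[Ux _]; exists x.
rewrite openE => y [yi yp]; apply: filterI.
  by apply: open_nbhs_nbhs; split=> //; exact: cimg_open.
by apply: (cinv_cont yi); apply: open_nbhs_nbhs; split=> //; apply: openI => //; exact: cdom_open.
Qed.

Definition atlas_smooth (A : set (chart R T n)) (U : set T) (f : T -> R^o) :=
  forall c, A c -> smooth_on (c @` (U `&` cdom c)) (f \o cinv c).

Lemma atlas_smoothD A U f g : open U ->
  atlas_smooth A U f -> atlas_smooth A U g ->
  atlas_smooth A U (fun x => f x + g x).
Proof.
move=> oU sf sg c Ac.
exact: smooth_onD (chart_img_open oU) (sf c Ac) (sg c Ac).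
Qed.

Definition atlas_structure A := FunStructure (@atlas_smoothD A).

End Atlas.

Definition smooth_map (R : realType) (T T' : topologicalType)
    (S : fun_structure R T) (S' : fun_structure R T') (h : T -> T') : Prop :=
  continuous h /\
  forall U f, open U -> S' U f -> S (h @^-1` U) (f \o h).

#[short(type="preTopGroupType")]
HB.structure Definition PreTopGroup := {G of Group G & Topological G}.

Record lieGroup (R : realType) := LieGroup {
  lg_sort :> preTopGroupType;
  lg_dim : nat;
  lg_atlas : set (chart R lg_sort lg_dim);
  lg_smooth_atlas : smooth_atlas lg_atlas;
  lg_hausdorff : hausdorff_space lg_sort;
  lg_second_countable : @second_countable lg_sort;
  lg_mul_cont : continuous (fun p : lg_sort * lg_sort => (p.1 * p.2)%g);
  lg_inv_cont : continuous (fun x : lg_sort => x^-1%g);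
  lg_mul_smooth : forall c1 c2 c3 j,
    lg_atlas c1 -> lg_atlas c2 -> lg_atlas c3 ->
    smooth_on
      [set z : 'rV[R]_(lg_dim + lg_dim) |
        [/\ (c1 @` cdom c1) (lsubmx z), (c2 @` cdom c2) (rsubmx z) &
            cdom c3 (cinv c1 (lsubmx z) * cinv c2 (rsubmx z))%g]]
      (fun z => c3 (cinv c1 (lsubmx z) * cinv c2 (rsubmx z))%g 0 j);
  lg_inv_smooth : forall c1 c2 j, lg_atlas c1 -> lg_atlas c2 ->
    smooth_on
      [set z | (c1 @` cdom c1) z /\ cdom c2 (cinv c1 z)^-1%g]
      (fun z => c2 (cinv c1 z)^-1%g 0 j) }.

Definition lg_structure (R : realType) (G : lieGroup R) : fun_structure R G :=
  atlas_structure (@lg_atlas R G).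

Record subgroup (G : groupType) := Subgroup {
  sg_set : set G;
  sg1 : sg_set 1%g;
  sgM : forall x y, sg_set x -> sg_set y -> sg_set (x * y)%g;
  sgV : forall x, sg_set x -> sg_set x^-1%g }.

Definition subspace_of (K : fieldType) (W : lmodType K) (A : set W) : Prop :=
  A 0 /\ forall (a : K) x y, A x -> A y -> A (a *: x + y).

Section LieAlgebra.
Variables (K : fieldType) (W : lmodType K) (br : W -> W -> W).

Definition subalgebra (A : set W) : Prop :=
  subspace_of A /\ forall x y, A x -> A y -> A (br x y).

Definition ideal_in (g A : set W) : Prop :=
  [/\ A `<=` g, subspace_of A & forall x y, g x -> A y -> A (br x y)].

Definition bracket_span (A B : set W) : set W :=
  [set x | forall L : set W, subspace_of L ->
     (forall a b, A a -> B b -> L (br a b)) -> L x].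

Fixpoint derived_series (A : set W) (k : nat) : set W :=
  if k is k'.+1
  then bracket_span (derived_series A k') (derived_series A k') else A.

Definition solvable_alg (A : set W) : Prop :=
  exists k, derived_series A k `<=` [set 0].

Fixpoint lower_central (A : set W) (k : nat) : set W :=
  if k is k'.+1 then bracket_span A (lower_central A k') else A.

Definition nilpotent_alg (A : set W) : Prop :=
  exists k, lower_central A k `<=` [set 0].

Definition semisimple_alg (g : set W) : Prop :=
  forall A, ideal_in g A -> solvable_alg A -> A `<=` [set 0].

(* In finite dimension a sum of two nilpotent ideals is a nilpotent ideal, so
   this union is the largest nilpotent ideal. *)
Definition nilradical (p : set W) : set W :=
  [set x | exists A, [/\ ideal_in p A, nilpotent_alg A & A x]].

End LieAlgebra.

Section Parabolic.
Variables (K : fieldType) (W : lmodType K) (br : W -> W -> W).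

(* The pair (x, y) of W * W stands for x + i y. *)
Definition cbracket (z w : W * W) : W * W :=
  (br z.1 w.1 - br z.2 w.2, br z.1 w.2 + br z.2 w.1).

Definition complexification (A : set W) : set (W * W) :=
  [set z | A z.1 /\ A z.2].

Definition complex_subalgebra (B : set (W * W)) : Prop :=
  subalgebra cbracket B /\ forall z, B z -> B (- z.2, z.1).

Definition borel_subalgebra (g b : set (W * W)) : Prop :=
  let P (c : set (W * W)) :=
    [/\ c `<=` g, complex_subalgebra c & solvable_alg cbracket c] in
  P b /\ forall c, P c -> b `<=` c -> c `<=` b.

Definition parabolic_subalgebra (g p : set W) : Prop :=
  [/\ p `<=` g, subalgebra br p &
      exists2 b, borel_subalgebra (complexification g) b &
                 b `<=` complexification p].

(* l is a Levi subalgebra of p: a complement of the nilradical. *)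
Definition levi_complement (p l : set W) : Prop :=
  (forall x, p x -> exists y z, [/\ l y, nilradical br p z & x = y + z]) /\
  l `&` nilradical br p `<=` [set 0].

Definition opposite_subalgebras (p q : set W) : Prop :=
  levi_complement p (p `&` q) /\ levi_complement q (p `&` q).

End Parabolic.

Section LieGroupTheory.
Variables (R : realType) (G : lieGroup R).

Definition is_smooth_fun (f : G -> R^o) : Prop := lg_structure G setT f.

(* Vector fields are the derivations of the algebra of smooth functions; such an
   operator is extended by 0 to the functions which are not smooth. *)
Definition operator := (G -> R^o) -> (G -> R^o).

Definition vector_field (X : operator) : Prop :=
  [/\ forall f, is_smooth_fun f -> is_smooth_fun (X f),
      forall f, ~ is_smooth_fun f -> X f = 0,
      forall (a : R) f g, is_smooth_fun f -> is_smooth_fun g ->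
        X (fun x => a * f x + g x) = (fun x => a * X f x + X g x) &
      forall f g, is_smooth_fun f -> is_smooth_fun g ->
        X (fun x => f x * g x) = (fun x => f x * X g x + X f x * g x)].

Definition lie_algebra : set operator :=
  [set X | vector_field X /\
     forall h f, is_smooth_fun f ->
       X (fun x => f (h * x)%g) = (fun x => X f (h * x)%g)].

Definition bracket (X Y : operator) : operator :=
  fun f x => X (Y f) x - Y (X f) x.

Definition semisimple_lie_group : Prop := semisimple_alg bracket lie_algebra.

(* Push-forward of vector fields along y |-> g y g^-1. *)
Definition Ad (g : G) (X : operator) : operator :=
  fun f x => X (fun y => f (g * y * g^-1)%g) (g^-1 * x * g)%g.

Definition normalizer_of (p : set operator) : set G :=
  [set g | Ad g @` p = p].

Definition parabolic_subgroup (P : subgroup G) : Prop :=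
  exists2 p, parabolic_subalgebra bracket lie_algebra p &
             sg_set P = normalizer_of p.

Definition opposite_parabolic_subgroups (P Q : subgroup G) : Prop :=
  exists p q,
    [/\ parabolic_subalgebra bracket lie_algebra p,
        parabolic_subalgebra bracket lie_algebra q,
        opposite_subalgebras bracket p q,
        sg_set P = normalizer_of p & sg_set Q = normalizer_of q].

Definition symmetric_subgroup (H : subgroup G) : Prop :=
  exists s : G -> G,
    [/\ {morph s : x y / (x * y)%g}, involutive s,
        smooth_map (lg_structure G) (lg_structure G) s,
        sg_set H `<=` [set x | s x = x] &
        connected_component [set x | s x = x] 1%g `<=` sg_set H].

End LieGroupTheory.

Section Coset.
Variables (G : preTopGroupType) (H : subgroup G).

Definition coset_rel (x y : G) : bool := `[< sg_set H (x^-1 * y)%g >].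

Lemma coset_rel_refl : reflexive coset_rel.
Proof. by move=> x; apply/asboolP; rewrite mulVg; exact: sg1. Qed.

Lemma coset_rel_sym : symmetric coset_rel.
Proof.
move=> x y; apply/idP/idP => /asboolP h; apply/asboolP;
by rewrite -[X in sg_set H X]invgK invgM invgK; apply: sgV.
Qed.

Lemma coset_rel_trans : transitive coset_rel.
Proof.
move=> y x z /asboolP h /asboolP k; apply/asboolP.
by have := sgM h k; rewrite -mulgA mulVKg.
Qed.

Canonical coset_equiv :=
  EquivRel coset_rel coset_rel_refl coset_rel_sym coset_rel_trans.

Definition coset_space := quotient_topology {eq_quot coset_rel}.

Definition coset_of (g : G) : coset_space := \pi_coset_space g.

Definition coset_act (g : G) (x : coset_space) : coset_space :=
  coset_of (g * repr x)%g.

Lemma coset_eqP x y : coset_of x = coset_of y <-> sg_set H (x^-1 * y)%g.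
Proof.
split=> [/eqmodP /asboolP //|h].
by apply/eqmodP/asboolP.
Qed.

Lemma coset_act_of g x : coset_act g (coset_of x) = coset_of (g * x)%g.
Proof.
rewrite /coset_act; apply/coset_eqP; rewrite invgM -mulgA mulKg.
by apply/coset_eqP; rewrite /coset_of reprK.
Qed.

Lemma coset_ofP (x : coset_space) : exists g, x = coset_of g.
Proof. by exists (repr x); rewrite /coset_of reprK. Qed.

Lemma coset_act1 x : coset_act 1%g x = x.
Proof. by have [g ->] := coset_ofP x; rewrite coset_act_of mul1g. Qed.

Lemma coset_actM g h x : coset_act (g * h)%g x = coset_act g (coset_act h x).
Proof. by have [k ->] := coset_ofP x; rewrite !coset_act_of mulgA. Qed.

End Coset.

Section Homogeneous.
Variables (R : realType) (G : lieGroup R) (H : subgroup G).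

(* The structure for which G -> G/H is a quotient map (a submersion). *)
Definition coset_smooth (U : set (coset_space H)) (f : coset_space H -> R^o) :=
  lg_structure G (@coset_of G H @^-1` U) (f \o @coset_of G H).

Lemma coset_smoothD U f g : open U -> coset_smooth U f -> coset_smooth U g ->
  coset_smooth U (fun x => f x + g x).
Proof.
move=> oU sf sg; apply: (fsD _ sf sg).
by move/continuousP : (@pi_continuous _ {eq_quot coset_rel H}); apply.
Qed.

Definition coset_structure := FunStructure coset_smoothD.

End Homogeneous.

Section Tangent.
Variables (R : realType) (T : topologicalType) (S : fun_structure R T).

(* Tangent vectors are point derivations of the smooth functions, extended by 0
   to the functions which are not smooth. The subspace topology on the pairs
   (x, v) with v tangent at x is that of the tangent bundle. *)
Definition functional : topologicalType := {ptws (T -> R^o) -> R^o}.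

Definition tangent (x : T) (v : functional) : Prop :=
  [/\ forall f, ~ S setT f -> v f = 0,
      forall (a : R) f g, S setT f -> S setT g ->
        v (fun y => a * f y + g y) = a * v f + v g &
      forall f g, S setT f -> S setT g ->
        v (fun y => f y * g y) = f x * v g + v f * g x].

Definition norm_on_tangent (x : T) (N : functional -> R^o) : Prop :=
  [/\ forall v, tangent x v -> 0 <= N v,
      forall v, tangent x v -> N v = 0 -> forall f, v f = 0,
      forall (a : R) v, tangent x v -> N (fun f => a * v f) = `|a| * N v &
      forall v w, tangent x v -> tangent x w ->
        N (fun f => v f + w f) <= N v + N w].

End Tangent.

Definition word_of_size (Gam : groupType) (s : seq Gam) (n : nat) (x : Gam) :=
  exists w : seq Gam,
    [/\ size w = n, forall y, y \in w -> y \in s \/ y^-1%g \in s &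
        x = foldr (fun y z => (y * z)%g) 1%g w].

Record genset (Gam : groupType) := GenSet {
  gens : seq Gam;
  gens_gen : forall x : Gam, exists n : nat, `[< word_of_size gens n x >] }.

Definition hyperbolic (R : realType) (X : Type) (d : X -> X -> R) : Prop :=
  exists delta : R, forall x y z w,
    d x z + d y w <= Num.max (d x y + d z w) (d x w + d y z) + delta.

Section WordMetric.
Variables (Gam : groupType) (S : genset Gam).

Definition word_length (x : Gam) : nat := ex_minn (gens_gen S x).

Definition word_dist (x y : Gam) : nat := word_length (x^-1 * y)%g.

Lemma word_lengthP x : word_of_size (gens S) (word_length x) x.
Proof. by rewrite /word_length; case: ex_minnP => n /asboolP. Qed.

Lemma word_length_min n x : word_of_size (gens S) n x -> (word_length x <= n)%N.
Proof.
by move=> h; rewrite /word_length; case: ex_minnP => m _; apply; apply/asboolP.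
Qed.

Lemma word_lengthM x y :
  (word_length (x * y)%g <= word_length x + word_length y)%N.
Proof.
have [u [su Su xE]] := word_lengthP x; have [v [sv Sv yE]] := word_lengthP y.
apply: word_length_min; exists (u ++ v); split.
- by rewrite size_cat su sv.
- by move=> z; rewrite mem_cat => /orP[/Su|/Sv].
- rewrite [in LHS]xE [in LHS]yE foldr_cat; elim: u {su Su xE} => [|a u IH] /=.
    by rewrite mul1g.
  by rewrite -mulgA IH.
Qed.

Lemma word_lengthV x : (word_length x^-1%g <= word_length x)%N.
Proof.
have [u [su Su xE]] := word_lengthP x; rewrite -su.
apply: word_length_min; exists (rev (map (fun y => y^-1%g) u)); split.
- by rewrite size_rev size_map.
- move=> z; rewrite mem_rev => /mapP[y /Su[yu|yu] ->]; rewrite ?invgK; tauto.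
- rewrite xE; elim: u {su Su xE} => [|a u IH] /=; first by rewrite invg1.
  rewrite invgM IH rev_cons -cats1 foldr_cat /= mulg1.
  elim: (rev _) => [|b r IHr] /=; first by rewrite mul1g.
  by rewrite -mulgA IHr.
Qed.

Lemma word_dist_sym x y : word_dist x y = word_dist y x.
Proof.
have le a b : (word_dist a b <= word_dist b a)%N.
  rewrite /word_dist -[X in (X <= _)%N]/(word_length _).
  by have := word_lengthV (b^-1 * a)%g; rewrite invgM invgK.
by apply/eqP; rewrite eqn_leq !le.
Qed.

Lemma word_dist_triangle x y z :
  (word_dist x z <= word_dist x y + word_dist y z)%N.
Proof.
by have := word_lengthM (x^-1 * y)%g (y^-1 * z)%g; rewrite -mulgA mulVKg.
Qed.

Lemma word_dist_mull g x y : word_dist (g * x)%g (g * y)%g = word_dist x y.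
Proof. by rewrite /word_dist invgM -mulgA mulKg. Qed.

Lemma word_dist0 x : word_dist x x = 0%N.
Proof.
apply/eqP; rewrite -leqn0; apply: word_length_min.
by exists [::]; split=> //=; rewrite mulVg.
Qed.

Definition word_hyperbolic (R : realType) : Prop :=
  hyperbolic (fun x y : Gam => (word_dist x y)%:R : R).

(* Geodesic rays of the Cayley graph, starting at any vertex. *)
Definition geodesic_rays : set {ptws nat -> discrete_topology Gam} :=
  [set r | forall m n : nat, word_dist (r m) (r n) = (m - n + (n - m))%N].

Definition ray : topologicalType := set_type geodesic_rays.

Definition ray_val (r : ray) : nat -> Gam := set_val r.

Definition asymptotic (r r' : ray) : bool :=
  `[< exists C : nat, forall n, (word_dist (ray_val r n) (ray_val r' n) <= C)%N >].

Lemma asymptotic_refl : reflexive asymptotic.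
Proof. by move=> r; apply/asboolP; exists 0%N => n; rewrite word_dist0. Qed.

Lemma asymptotic_sym : symmetric asymptotic.
Proof.
by move=> r r'; apply/idP/idP => /asboolP[C h]; apply/asboolP; exists C => n;
  rewrite word_dist_sym.
Qed.

Lemma asymptotic_trans : transitive asymptotic.
Proof.
move=> r r1 r2 /asboolP[C h] /asboolP[C' h']; apply/asboolP.
exists (C + C')%N => n; apply: leq_trans (word_dist_triangle _ (ray_val r n) _) _.
exact: leq_add.
Qed.

Canonical asymptotic_equiv :=
  EquivRel asymptotic asymptotic_refl asymptotic_sym asymptotic_trans.

Definition boundary := quotient_topology {eq_quot asymptotic}.

Definition ray_class (r : ray) : boundary := \pi_boundary r.

Lemma ray_act_subproof (g : Gam) (r : ray) :
  (fun n => g * ray_val r n)%g \in geodesic_rays.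
Proof.
by apply/mem_set => m n; rewrite word_dist_mull; exact: (set_mem (valP r)).
Qed.

Definition ray_act (g : Gam) (r : ray) : ray :=
  exist (fun s => s \in geodesic_rays) _ (ray_act_subproof g r).

Definition boundary_act (g : Gam) (t : boundary) : boundary :=
  ray_class (ray_act g (repr t)).

End WordMetric.

Definition quasi_isometric_embedding (R : realType) (X Y : Type)
    (dX : X -> X -> R) (dY : Y -> Y -> R) (f : X -> Y) : Prop :=
  exists L c : R, [/\ 0 < L, 0 <= c &
    forall x x', dX x x' / L - c <= dY (f x) (f x') <= L * dX x x' + c].

Definition quasi_isometry (R : realType) (X Y : Type)
    (dX : X -> X -> R) (dY : Y -> Y -> R) (f : X -> Y) : Prop :=
  quasi_isometric_embedding dX dY f /\
  exists c : R, forall y, exists x, dY y (f x) <= c.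

Section FlowSpace.
Variables (R : realType) (Gam : groupType) (S : genset Gam).

(* The half-orbit t |-> c t (t >= 0) and the orbit of x along a geodesic ray
   representing xi are at finite Hausdorff distance. *)
Definition converges_to (X : metricType R) (act : Gam -> X -> X)
    (c : R -> X) (xi : boundary S) : Prop :=
  exists (r : ray S) (x : X) (D : R),
    [/\ ray_class r = xi,
        forall t, 0 <= t -> exists n, mdist (c t) (act (ray_val r n) x) <= D &
        forall n, exists2 t, 0 <= t & mdist (c t) (act (ray_val r n) x) <= D].

(* Together, [fl_act], [fl_flow] and [fl_flip] form an action of
   Gam x (R x| Z/2), the flip acting on R by t |-> - t. *)
Record flow_space := FlowSpace {
  fl_sort :> metricType R;
  fl_proper : forall (x : fl_sort) (r : R), compact [set y | mdist x y <= r];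
  fl_hyperbolic : hyperbolic (@mdist R fl_sort);
  fl_act : Gam -> fl_sort -> fl_sort;
  fl_act1 : forall x, fl_act 1%g x = x;
  fl_actM : forall g h x, fl_act (g * h)%g x = fl_act g (fl_act h x);
  fl_act_isom : forall g x y, mdist (fl_act g x) (fl_act g y) = mdist x y;
  fl_flip : fl_sort -> fl_sort;
  fl_flipK : involutive fl_flip;
  fl_flip_isom : forall x y, mdist (fl_flip x) (fl_flip y) = mdist x y;
  fl_flow : R -> fl_sort -> fl_sort;
  fl_flow0 : forall x, fl_flow 0 x = x;
  fl_flowD : forall s t x, fl_flow (s + t) x = fl_flow s (fl_flow t x);
  fl_flow_cont : continuous (fun p : R^o * fl_sort => fl_flow p.1 p.2);
  fl_act_flip : forall g x, fl_act g (fl_flip x) = fl_flip (fl_act g x);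
  fl_act_flow : forall g t x, fl_act g (fl_flow t x) = fl_flow t (fl_act g x);
  fl_flip_flow : forall t x, fl_flip (fl_flow t x) = fl_flow (- t) (fl_flip x);
  fl_flow_free : forall t x, fl_flow t x = x -> t = 0;
  fl_orbit_qi : forall x, quasi_isometry
    (fun g h : Gam => (word_dist S g h)%:R) (@mdist R fl_sort)
    (fun g => fl_act g x);
  fl_flow_qi : forall x, quasi_isometric_embedding
    (fun s t : R => `|s - t|) (@mdist R fl_sort) (fun t => fl_flow t x);
  fl_plus : fl_sort -> boundary S;
  fl_minus : fl_sort -> boundary S;
  fl_plusP : forall x, converges_to fl_act (fun t => fl_flow t x) (fl_plus x);
  fl_minusP : forall x,
    converges_to fl_act (fun t => fl_flow (- t) x) (fl_minus x);
  (* the map induced by (fl_plus, fl_minus) on the space of flow lines is a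
     homeomorphism onto the pairs of distinct points of the boundary *)
  fl_range : forall a b, a <> b <-> exists x, fl_plus x = a /\ fl_minus x = b;
  fl_fibre : forall x y, fl_plus x = fl_plus y -> fl_minus x = fl_minus y ->
    exists t, y = fl_flow t x;
  fl_plus_cont : continuous fl_plus;
  fl_minus_cont : continuous fl_minus;
  fl_open : forall U : set fl_sort, open U ->
    exists2 O : set (boundary S * boundary S), open O &
      (fun x => (fl_plus x, fl_minus x)) @` U = O `&` [set p | p.1 <> p.2] }.

End FlowSpace.

Section Anosov.
Variables (R : realType) (Gam : groupType) (S : genset Gam).
Variables (X : flow_space R S) (G : lieGroup R).
Variable rho : Gam -> G.

(* A continuous equivariant family of norms N on the tangent spaces of G/P at
   the points x(m), m in X, contracted by psi. *)
Definition contracting (P : subgroup G) (x : X -> coset_space P)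
    (psi : R -> X -> X) : Prop :=
  exists N : X -> functional R (coset_space P) -> R^o,
  [/\ forall m, norm_on_tangent (coset_structure P) (x m) (N m),
      forall g m v, tangent (coset_structure P) (x m) v ->
        N (fl_act g m) (fun f => v (f \o coset_act (rho g))) = N m v,
      {within [set p : X * functional R (coset_space P) |
                tangent (coset_structure P) (x p.1) p.2],
        continuous (fun p => N p.1 p.2)} &
      exists A a : R, [/\ 0 < A, 0 < a &
        forall t m v, 0 <= t -> tangent (coset_structure P) (x m) v ->
          N (psi t m) v <= A * expR (- (a * t)) * N m v]].

(* p lies in the open orbit of the diagonal action. *)
Definition transverse (P Q : subgroup G)
    (p : coset_space P * coset_space Q) : Prop :=
  open [set (coset_act g p.1, coset_act g p.2) | g in [set: G]].

Definition anosov (P Q : subgroup G) : Prop :=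
  exists (xiP : boundary S -> coset_space P) (xiQ : boundary S -> coset_space Q),
  [/\ continuous xiP /\ continuous xiQ,
      (forall g t, xiP (boundary_act g t) = coset_act (rho g) (xiP t)) /\
      (forall g t, xiQ (boundary_act g t) = coset_act (rho g) (xiQ t)),
      forall a b, a <> b -> transverse (xiP a, xiQ b),
      contracting (xiP \o @fl_plus _ _ _ X) (fun t => @fl_flow _ _ _ X (- t)) &
      contracting (xiQ \o @fl_minus _ _ _ X) (@fl_flow _ _ _ X)].

End Anosov.

Record domain_of_discontinuity (R : realType) (Gam : groupType)
    (G : lieGroup R) (rho : Gam -> G) (H : subgroup G) := Domain {
  dod : set (coset_space H);
  dod_open : open dod;
  dod_inv : forall g x, dod x -> dod (coset_act (rho g) x);
  dod_proper : forall K : set (coset_space H), compact K -> K `<=` dod ->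
    finite_set [set g | (coset_act (rho g) @` K) `&` K !=set0] }.

Definition dod_type (R : realType) (Gam : groupType) (G : lieGroup R)
    (rho : Gam -> G) (H : subgroup G) (Om : domain_of_discontinuity rho H)
  : topologicalType := set_type (dod Om).

Section DomainStructure.
Variables (R : realType) (Gam : groupType) (G : lieGroup R).
Variables (rho : Gam -> G) (H : subgroup G) (Om : domain_of_discontinuity rho H).

Definition dod_val (m : dod_type Om) : coset_space H := set_val m.

Definition dod_smooth (U : set (dod_type Om)) (f : dod_type Om -> R^o) : Prop :=
  exists2 F : coset_space H -> R^o, (forall m, F (dod_val m) = f m) &
    coset_structure H (dod_val @` U) F.

Lemma dod_image_open (U : set (dod_type Om)) : open U -> open (dod_val @` U).
Proof.
move=> [V oV <-].
have -> : dod_val @` (set_val @^-1` V) = V `&` dod Om.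
  apply/seteqP; split=> [_ [m Vm <-]|x [Vx Ox]].
    by split=> //; exact: (set_mem (valP m)).
  by exists (exist (fun x => x \in dod Om) x (mem_set Ox)).
by apply: openI => //; exact: dod_open.
Qed.

Lemma dod_smoothD U f g : open U -> dod_smooth U f -> dod_smooth U g ->
  dod_smooth U (fun x => f x + g x).
Proof.
move=> oU [F Ff sF] [F' Fg sF']; exists (fun x => F x + F' x).
  by move=> m; rewrite Ff Fg.
by apply: fsD sF sF'; exact: dod_image_open.
Qed.

Definition dod_structure := FunStructure dod_smoothD.

End DomainStructure.

Section ImageGroup.
Variables (Gam G : groupType) (rho : Multiplicative.type Gam G).

Definition image_group : Type := set_type (range rho).
HB.instance Definition _ := Choice.on image_group.

Definition in_image (g : Gam) : image_group :=
  exist (fun x => x \in range rho) (rho g) (mem_set (imageT rho g)).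

Definition image_val (x : image_group) : G := set_val x.

Lemma image_valK (x : image_group) : exists g, x = in_image g.
Proof.
by have [g _ gx] := set_mem (valP x); exists g; apply: val_inj; rewrite /= gx.
Qed.

Lemma image_mul_subproof (x y : image_group) :
  (image_val x * image_val y)%g \in range rho.
Proof.
have [[g ->] [h ->]] := (image_valK x, image_valK y); apply/mem_set.
by exists (g * h)%g => //; rewrite gmulfM.
Qed.

Lemma image_morph1 : rho 1%g = 1%g.
Proof.
have : rho (1 * 1)%g = (rho 1 * rho 1)%g by exact: gmulfM.
by rewrite mulg1 => e; rewrite -[LHS](mulKg (rho 1%g)) -e mulVg.
Qed.

Lemma image_one_subproof : (1%g : G) \in range rho.
Proof. by apply/mem_set; exists 1%g => //; exact: image_morph1. Qed.

Lemma image_inv_subproof (x : image_group) : (image_val x)^-1%g \in range rho.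
Proof.
have [g ->] := image_valK x; apply/mem_set; exists g^-1%g => //.
have : rho (g^-1 * g)%g = (rho g^-1 * rho g)%g by exact: gmulfM.
by rewrite mulVg image_morph1 => e; rewrite -[RHS]mul1g e mulgK.
Qed.

Let imul x y : image_group :=
  exist (fun z => z \in range rho) _ (image_mul_subproof x y).
Let ione : image_group := exist (fun z => z \in range rho) _ image_one_subproof.
Let iinv x : image_group :=
  exist (fun z => z \in range rho) _ (image_inv_subproof x).

Fact image_mulA : associative imul.
Proof. by move=> x y z; apply: val_inj; rewrite /= mulgA. Qed.
Fact image_mul1 : left_id ione imul.
Proof. by move=> x; apply: val_inj; rewrite /= mul1g. Qed.
Fact image_1mul : right_id ione imul.
Proof. by move=> x; apply: val_inj; rewrite /= mulg1. Qed.
Fact image_mulV : left_inverse ione iinv imul.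
Proof. by move=> x; apply: val_inj; rewrite /= mulVg. Qed.
Fact image_Vmul : right_inverse ione iinv imul.
Proof. by move=> x; apply: val_inj; rewrite /= mulgV. Qed.

HB.instance Definition _ := isGroup.Build image_group
  image_mulA image_mul1 image_1mul image_mulV image_Vmul.

Lemma image_valM (x y : image_group) :
  image_val (x * y)%g = (image_val x * image_val y)%g.
Proof. by []. Qed.

Lemma image_val1 : image_val 1%g = 1%g.
Proof. by []. Qed.

End ImageGroup.

Section DomainAction.
Variables (R : realType) (Gam : groupType) (G : lieGroup R).
Variables (rho : Multiplicative.type Gam G) (H : subgroup G).
Variable Om : domain_of_discontinuity rho H.

Lemma dod_act_subproof (g : image_group rho) (m : dod_type Om) :
  coset_act (image_val g) (dod_val m) \in dod Om.
Proof.
have [h ->] := image_valK g; apply/mem_set.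
by apply: dod_inv; exact: (set_mem (valP m)).
Qed.

Definition dod_act (g : image_group rho) (m : dod_type Om) : dod_type Om :=
  exist (fun x => x \in dod Om) _ (dod_act_subproof g m).

Lemma dod_act1 m : dod_act 1%g m = m.
Proof. by apply: val_inj; rewrite /= image_val1 coset_act1. Qed.

Lemma dod_actM g h m : dod_act (g * h)%g m = dod_act g (dod_act h m).
Proof. by apply: val_inj; rewrite /= image_valM coset_actM. Qed.

End DomainAction.

Section ComplexCurve.
Variable R : realType.

Definition toC (v : 'rV[R]_2) : R[i] := (v 0 0 +i* v 0 1)%C.
Definition ofC (z : R[i]) : 'rV[R]_2 :=
  \row_j (if j == 0 then complex.Re z else complex.Im z).

Definition holomorphic_on (U : set 'rV[R]_2) (f : 'rV[R]_2 -> R[i]) : Prop :=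
  forall v, U v ->
    derivable (fun z : R[i]^o => (f (ofC z) : R[i]^o)) (toC v : R[i]^o) 1.

(* A holomorphic atlas, with values in C = R^2, all of whose charts are
   diffeomorphisms for the smooth structure S. *)
Record complex_curve (M : topologicalType) (S : fun_structure R M) :=
  ComplexCurve {
  cc_atlas : set (chart R M 2);
  cc_cover : forall m, exists2 c, cc_atlas c & cdom c m;
  cc_smooth : forall c U f, cc_atlas c -> open U -> U `<=` cdom c ->
    S U f <-> smooth_on (c @` U) (f \o cinv c);
  cc_transition : forall c c', cc_atlas c -> cc_atlas c' ->
    holomorphic_on (c @` (cdom c `&` cdom c')) (fun v => toC (c' (cinv c v))) }.

End ComplexCurve.

Section HiggsBundles.
Variables (R : realType) (M : topologicalType) (S : fun_structure R M).
Variable J : complex_curve S.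
Local Notation C := (R[i]^o).

Definition smoothC (f : M -> C) : Prop :=
  S setT (fun m => complex.Re (f m)) /\ S setT (fun m => complex.Im (f m)).

Definition holomorphic (U : set M) (f : M -> C) : Prop :=
  forall c, cc_atlas J c -> holomorphic_on (c @` (U `&` cdom c)) (f \o cinv c).

Definition holomorphic_at (m : M) (f : M -> C) : Prop :=
  exists U, [/\ open U, U m & holomorphic U f].

Definition antiholomorphic_at (m : M) (f : M -> C) : Prop :=
  holomorphic_at m (fun x => (f x)^*%C).

Definition holomorphic_map (h : M -> M) : Prop :=
  smooth_map S S h /\
  forall U f, open U -> holomorphic U f -> holomorphic (h @^-1` U) (f \o h).

Definition biholomorphism (h : M -> M) : Prop :=
  exists k, [/\ cancel h k, cancel k h, holomorphic_map h & holomorphic_map k].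

(* Elements of TM (x) C at m are the C-linear point derivations at m of the
   complex valued smooth functions, extended by 0 to the other functions. *)
Definition cfunctional := (M -> C) -> C.
Local Notation V := cfunctional.

Definition ctangent (m : M) (v : V) : Prop :=
  [/\ forall f, ~ smoothC f -> v f = 0,
      forall (a : C) f g, smoothC f -> smoothC g ->
        v (fun x => a * f x + g x) = a * v f + v g &
      forall f g, smoothC f -> smoothC g ->
        v (fun x => f x * g x) = f m * v g + v f * g m].

(* T^{1,0} is the space of derivations killing the antiholomorphic germs. *)
Definition T10 (m : M) : set V :=
  [set v | ctangent m v /\
    forall f, smoothC f -> antiholomorphic_at m f -> v f = 0].

Definition T01 (m : M) : set V :=
  [set v | ctangent m v /\
    forall f, smoothC f -> holomorphic_at m f -> v f = 0].

Definition smooth_section (E : M -> set V) (s : M -> V) : Prop :=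
  (forall m, E m (s m)) /\
  forall f, smoothC f -> smoothC (fun m => s m f).

(* A complex vector bundle over M all of whose fibers are spaces of functionals
   on smooth functions, such as the pull-backs of T^{1,0}M; its smooth structure
   is given by [smooth_section]. *)
Record bundle := Bundle {
  fib :> M -> set V;
  fib_sub : forall m, subspace_of (fib m) }.

Definition section (E : M -> set V) : Type := {s : M -> V | smooth_section E s}.

Definition sec_val (E : M -> set V) (s : section E) : M -> V := sval s.
Local Coercion sec_val : section >-> Funclass.

(* Smooth E-valued forms of type (1,0) if F is T10, of type (0,1) if F is T01:
   at m, a linear map F m -> E m, extended by 0 outside of F m. *)
Definition is_form (F E : M -> set V) (eta : M -> V -> V) : Prop :=
  [/\ forall m X, F m X -> E m (eta m X),
      forall m X, ~ F m X -> eta m X = 0,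
      forall m (a : C) X Y, F m X -> F m Y ->
        eta m (a *: X + Y) = a *: eta m X + eta m Y &
      forall X, smooth_section F X -> smooth_section E (fun m => eta m (X m))].

(* The same for forms with values in End(E): at m, F m -> End(E m). *)
Definition is_endform (F E : M -> set V) (eta : M -> V -> V -> V) : Prop :=
  [/\ forall m X v, F m X -> E m v -> E m (eta m X v),
      forall m X v, ~ (F m X /\ E m v) -> eta m X v = 0,
      forall m (a : C) X Y v, F m X -> F m Y -> E m v ->
        eta m (a *: X + Y) v = a *: eta m X v + eta m Y v,
      forall m (a : C) X u v, F m X -> E m u -> E m v ->
        eta m X (a *: u + v) = a *: eta m X u + eta m X v &
      forall X s, smooth_section F X -> smooth_section E s ->
        smooth_section E (fun m => eta m (X m) (s m))].

(* Each fiber of the form bundle being finite-dimensional, its vector space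
   topology is that of pointwise convergence of the values eta m X v f. *)
Definition endform_space : topologicalType :=
  {ptws M -> {ptws V -> {ptws V -> {ptws (M -> C) -> C}}}}.

Definition endforms (F E : M -> set V) : topologicalType :=
  set_type [set eta : endform_space | is_endform F E eta].

Definition endform_val F E (eta : endforms F E) : M -> V -> V -> V :=
  set_val eta.

Definition is_pseudo_connection (E : M -> set V)
    (D : section E -> M -> V -> V) : Prop :=
  [/\ forall s, is_form T01 E (D s),
      forall (a : C) (s t u : section E),
        (forall m, u m = a *: s m + t m) ->
        forall m X, T01 m X -> D u m X = a *: D s m X + D t m X &
      forall (f : M -> C) (s u : section E), smoothC f ->
        (forall m, u m = f m *: s m) ->
        forall m X, T01 m X -> D u m X = X f *: s m + f m *: D s m X].

Definition pseudo_connection (E : M -> set V) : Type :=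
  set_type [set D | @is_pseudo_connection E D].
HB.instance Definition _ E := Choice.on (pseudo_connection E).

Definition pc_val E (D : pseudo_connection E) : section E -> M -> V -> V :=
  set_val D.

Lemma subspace0 (E : bundle) m : E m 0.
Proof. by have [] := fib_sub E m. Qed.

Lemma subspaceP (E : bundle) m (a : C) u v : E m u -> E m v -> E m (a *: u + v).
Proof. by have [_] := fib_sub E m; apply. Qed.

Lemma subspaceD (E : bundle) m u v : E m u -> E m v -> E m (u + v).
Proof. by move=> Eu Ev; rewrite -[u]scale1r; exact: subspaceP. Qed.

Lemma smoothCD f g : smoothC f -> smoothC g -> smoothC (fun m => f m + g m).
Proof.
move=> [rf jf] [rg jg]; split.
  have -> : (fun m => complex.Re (f m + g m)) =
            (fun m => complex.Re (f m) + complex.Re (g m)).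
    by apply/funext => m; case: (f m) (g m) => [? ?] [? ?].
  by apply: (fsD _ rf rg); exact: openT.
have -> : (fun m => complex.Im (f m + g m)) =
          (fun m => complex.Im (f m) + complex.Im (g m)).
  by apply/funext => m; case: (f m) (g m) => [? ?] [? ?].
by apply: (fsD _ jf jg); exact: openT.
Qed.

Lemma smooth_sectionD (E : bundle) s t : smooth_section E s ->
  smooth_section E t -> smooth_section E (fun m => s m + t m).
Proof.
move=> [Es ss] [Et st]; split=> [m|f sf]; first exact: subspaceD.
exact: smoothCD (ss f sf) (st f sf).
Qed.

Section Shift.
Variables (E : bundle) (B : pseudo_connection E).

Definition pc_shift_fun (A : endforms T01 E) : section E -> M -> V -> V :=
  fun s m X => pc_val B s m X + endform_val A m X (s m).

Lemma pc_shift_subproof (A : endforms T01 E) :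
  pc_shift_fun A \in [set D | @is_pseudo_connection E D].
Proof.
have [Bf Bl BL] : is_pseudo_connection (pc_val B) := set_mem (valP B).
have [Am A0 AX Av As] : is_endform T01 E (endform_val A) := set_mem (valP A).
apply/mem_set; split=> [s|a s t u uE m X TX|f s u sf uE m X TX].
- have [Bm B0 BX Bs] := Bf s; have [Es _] := svalP s; split.
  + by move=> m X TX; apply: subspaceD; [exact: Bm|exact: Am].
  + by move=> m X TX; rewrite /pc_shift_fun B0 // A0 ?addr0 // => -[].
  + move=> m a X Y TX TY; have Esm := Es m; rewrite /pc_shift_fun BX // AX //.
    by rewrite scalerDr !addrA [X in X + _ = _]addrAC.
  + by move=> X sX; apply: smooth_sectionD; [exact: Bs|apply: As => //; exact: svalP].
- have [Es _] := svalP s; have [Et _] := svalP t.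
  have [Esm Etm] := (Es m, Et m).
  rewrite /pc_shift_fun (Bl _ _ _ _ uE) // uE Av //.
  by rewrite scalerDr !addrA [X in X + _ = _]addrAC.
- have [Es _] := svalP s; rewrite /pc_shift_fun (BL _ _ _ sf uE) // uE.
  have := Av m (f m) X (sec_val s m) 0 TX (Es m) (subspace0 E m).
  have A00 : endform_val A m X 0 = 0.
    have := Av m (-1) X 0 0 TX (subspace0 E m) (subspace0 E m).
    by rewrite scaler0 addr0 scaleN1r addNr.
  by rewrite A00 !addr0 => ->; rewrite scalerDr !addrA.
Qed.

Definition pc_shift (A : endforms T01 E) : pseudo_connection E :=
  exist (fun D => D \in [set D | @is_pseudo_connection E D]) _
    (pc_shift_subproof A).

End Shift.

(* The space of pseudo-connections on E, with the topology for which
   A |-> B + A is a homeomorphism. *)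
Definition based_connections (E : bundle) (B : pseudo_connection E) : Type :=
  pseudo_connection E.

Section BasedConnections.
Variables (E : bundle) (B : pseudo_connection E).
Local Notation conn := (based_connections B).
HB.instance Definition _ := Choice.on conn.

Definition pc_open (U : set conn) : Prop := open (pc_shift B @^-1` U).

Lemma pc_openT : pc_open setT.
Proof. by rewrite /pc_open preimage_setT; exact: openT. Qed.
Lemma pc_openI : setI_closed pc_open.
Proof. by move=> U W oU oW; rewrite /pc_open preimage_setI; exact: openI. Qed.
Lemma pc_open_bigU (I : Type) (U : I -> set conn) :
  (forall i, pc_open (U i)) -> pc_open (\bigcup_i U i).
Proof.
by move=> oU; rewrite /pc_open preimage_bigcup; apply: bigcup_open => i _; exact: oU.
Qed.

HB.instance Definition _ :=
  isOpenTopological.Build conn pc_openT pc_openI pc_open_bigU.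

End BasedConnections.

Definition vf_bracket (X Y : M -> V) : M -> V :=
  fun m f => X m (fun x => Y x f) - Y m (fun x => X x f).

Section Equations.
Variables (E : M -> set V) (D : section E -> M -> V -> V).
Variable phi : M -> V -> V -> V.

(* D_X s, as a relation since it is a section only for X of type (0,1). *)
Definition along (s : section E) (X : M -> V) (t : section E) : Prop :=
  forall m, t m = D s m (X m).

(* D^2 s (X, Y) = D_X D_Y s - D_Y D_X s - D_[X,Y] s. *)
Definition flat : Prop :=
  forall X Y (s sX sY : section E),
    smooth_section T01 X -> smooth_section T01 Y ->
    along s X sX -> along s Y sY ->
    forall m, D sY m (X m) - D sX m (Y m) - D s m (vf_bracket X Y m) = 0.

(* (D phi)(Y, X) s = D_Y (phi(X) s) - phi(X) D_Y s - phi([Y,X]) s, for Y of type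
   (0,1) and X of type (1,0); phi only sees the (1,0)-part Z of [Y,X]. *)
Definition phi_holomorphic : Prop :=
  forall X Y (s sphi sY : section E),
    smooth_section T10 X -> smooth_section T01 Y ->
    (forall m, sphi m = phi m (X m) (s m)) -> along s Y sY ->
    forall m Z Z', T10 m Z -> T01 m Z' -> vf_bracket Y X m = Z + Z' ->
      D sphi m (Y m) - phi m (X m) (sY m) - phi m Z (s m) = 0.

Definition phi_wedge_phi_zero : Prop :=
  forall m X Y v, T10 m X -> T10 m Y -> E m v ->
    phi m X (phi m Y v) - phi m Y (phi m X v) = 0.

Definition higgs_equations : Prop :=
  [/\ flat, phi_holomorphic & phi_wedge_phi_zero].

End Equations.

(* Higgs bundle structures on E, topologized by means of the connection B. *)
Definition higgs (E : bundle) (B : pseudo_connection E) : topologicalType :=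
  set_type [set x : based_connections B * endforms T10 E |
    higgs_equations (pc_val x.1) (endform_val x.2)].

(* Smooth isomorphisms of complex vector bundles over the identity of M. *)
Record bundle_iso (E E' : bundle) := BundleIso {
  bi_fun : M -> V -> V;
  bi_inv : M -> V -> V;
  bi_mem : forall m v, E m v -> E' m (bi_fun m v);
  bi_inv_mem : forall m v, E' m v -> E m (bi_inv m v);
  bi_lin : forall m (a : C) u v, E m u -> E m v ->
    bi_fun m (a *: u + v) = a *: bi_fun m u + bi_fun m v;
  bi_inv_lin : forall m (a : C) u v, E' m u -> E' m v ->
    bi_inv m (a *: u + v) = a *: bi_inv m u + bi_inv m v;
  bi_funK : forall m v, E m v -> bi_inv m (bi_fun m v) = v;
  bi_invK : forall m v, E' m v -> bi_fun m (bi_inv m v) = v;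
  bi_smooth : forall s, smooth_section E s ->
    smooth_section E' (fun m => bi_fun m (s m));
  bi_inv_smooth : forall s, smooth_section E' s ->
    smooth_section E (fun m => bi_inv m (s m)) }.

Definition bi_id (E : bundle) : bundle_iso E E :=
  @BundleIso E E (fun _ v => v) (fun _ v => v) (fun _ _ h => h) (fun _ _ h => h)
    (fun _ _ _ _ _ _ => erefl) (fun _ _ _ _ _ _ => erefl)
    (fun _ _ _ => erefl) (fun _ _ _ => erefl) (fun _ h => h) (fun _ h => h).

Definition bi_sym (E E' : bundle) (t : bundle_iso E E') : bundle_iso E' E :=
  BundleIso (bi_inv_mem t) (bi_mem t) (bi_inv_lin t) (bi_lin t)
    (bi_invK t) (bi_funK t) (bi_inv_smooth t) (bi_smooth t).

Definition bi_comp (E E' E'' : bundle) (u : bundle_iso E' E'')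
    (t : bundle_iso E E') : bundle_iso E E''.
Proof.
apply: (@BundleIso E E'' (fun m v => bi_fun u m (bi_fun t m v))
  (fun m v => bi_inv t m (bi_inv u m v))).
- by move=> m v Ev; do 2 apply: bi_mem.
- by move=> m v Ev; do 2 apply: bi_inv_mem.
- by move=> m a v w Ev Ew; rewrite (bi_lin t) // (bi_lin u) //; exact: bi_mem.
- by move=> m a v w Ev Ew; rewrite (bi_inv_lin u) // (bi_inv_lin t) //;
    exact: bi_inv_mem.
- by move=> m v Ev; rewrite (bi_funK u) ?(bi_funK t) //; exact: bi_mem.
- by move=> m v Ev; rewrite (bi_invK t) ?(bi_invK u) //; exact: bi_inv_mem.
- by move=> s ss; apply: (bi_smooth u); exact: (bi_smooth t).
- by move=> s ss; apply: (bi_inv_smooth t); exact: (bi_inv_smooth u).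
Defined.

Section Transport.
Variables (E E' : bundle) (t : bundle_iso E E').

Definition section_map (s : section E) : section E' :=
  exist _ (fun m => bi_fun t m (s m)) (bi_smooth t (svalP s)).

Definition section_inv (s : section E') : section E :=
  exist _ (fun m => bi_inv t m (s m)) (bi_inv_smooth t (svalP s)).

(* t o D o t^-1 and t o phi o t^-1: the gauge action when t is an automorphism
   of E, and the action of a group element g when t is g : E^g' -> E^(gg'). *)
Definition pc_conj (D : section E -> M -> V -> V) : section E' -> M -> V -> V :=
  fun s m X => bi_fun t m (D (section_inv s) m X).

Definition endform_conj (phi : M -> V -> V -> V) : M -> V -> V -> V :=
  fun m X v => if `[< E' m v >] then bi_fun t m (phi m X (bi_inv t m v)) else 0.

Lemma section_eq (F : M -> set V) (s u : section F) : (forall m, s m = u m) -> s = u.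
Proof.
case: s u => [s ss] [u su] /= su_eq.
have e : s = u by apply/funext.
by case: _ / e su su_eq => su _; congr exist; exact: Prop_irrelevance.
Qed.

Lemma bi_fun0 (F F' : bundle) (u : bundle_iso F F') m : bi_fun u m 0 = 0.
Proof.
have := bi_lin u (-1) (subspace0 F m) (subspace0 F m).
by rewrite scaler0 addr0 scaleN1r addNr.
Qed.

Lemma bi_funZ (F F' : bundle) (u : bundle_iso F F') m (a : C) v :
  F m v -> bi_fun u m (a *: v) = a *: bi_fun u m v.
Proof.
by move=> Fv; have := bi_lin u a Fv (subspace0 F m); rewrite !addr0 bi_fun0 addr0.
Qed.

Lemma bi_funB (F F' : bundle) (u : bundle_iso F F') m v w :
  F m v -> F m w -> bi_fun u m (v - w) = bi_fun u m v - bi_fun u m w.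
Proof.
move=> Fv Fw; have := bi_lin u (-1) Fw Fv.
by rewrite !scaleN1r addrC => ->; rewrite addrC.
Qed.

Lemma subspaceB (F : bundle) m v w : F m v -> F m w -> F m (v - w).
Proof.
by move=> Fv Fw; rewrite addrC -scaleN1r; exact: subspaceP.
Qed.

Lemma form_mem (F : M -> set V) (E0 : bundle) eta m X :
  is_form F E0 eta -> E0 m (eta m X).
Proof.
move=> [h1 h2 _ _]; have [FX|nFX] := pselect (F m X); first exact: h1.
by rewrite h2 //; exact: subspace0.
Qed.

Lemma endform_mem (F : M -> set V) (E0 : bundle) eta m X v :
  is_endform F E0 eta -> E0 m (eta m X v).
Proof.
move=> [h1 h2 _ _ _]; have [[FX Ev]|n] := pselect (F m X /\ E0 m v).
  exact: h1.
by rewrite h2 //; exact: subspace0.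
Qed.

Lemma pc_conjP D : is_pseudo_connection D -> is_pseudo_connection (pc_conj D).
Proof.
move=> [Df Dl DL]; split=> [s|a s u w wE m X TX|f s u sf uE m X TX].
- have Dfs := Df (section_inv s); have [Dm D0 DX Ds] := Dfs; split.
  + by move=> m X TX; apply: bi_mem; exact: Dm.
  + by move=> m X TX; rewrite /pc_conj D0 // bi_fun0.
  + move=> m a X Y TX TY; rewrite /pc_conj DX // bi_lin //; exact: form_mem Dfs.
  + by move=> X sX; apply: bi_smooth; exact: Ds.
- have [Es _] := svalP s; have [Eu _] := svalP u.
  rewrite /pc_conj (Dl a (section_inv s) (section_inv u) (section_inv w)) //.
    by rewrite bi_lin //; exact: form_mem (Df _).
  by move=> x; rewrite /= wE bi_inv_lin.
- have [Es _] := svalP s.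
  rewrite /pc_conj (DL f (section_inv s) (section_inv u)) //.
    have Eis : E m (section_inv s m) by apply: bi_inv_mem; exact: Es.
    have Efd : E m (f m *: D (section_inv s) m X).
      rewrite -[_ *: _]addr0; apply: subspaceP; last exact: subspace0.
      exact: form_mem (Df _).
    rewrite bi_lin // bi_funZ; last exact: form_mem (Df _).
    by rewrite /= bi_invK //; exact: Es.
  move=> x; rewrite /= uE; exact: (bi_funZ (bi_sym t) (f x) (Es x)).
Qed.

Lemma endform_conjP F phi : is_endform F E phi -> is_endform F E' (endform_conj phi).
Proof.
move=> Hphi; have [h1 h2 h3 h4 h5] := Hphi; split.
- move=> m X v FX Ev; rewrite /endform_conj asboolT //; apply: bi_mem.
  exact: endform_mem Hphi.
- move=> m X v n; rewrite /endform_conj; case: asboolP => // Ev.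
  by rewrite h2 ?bi_fun0 // => -[FX _]; apply: n.
- move=> m a X Y v FX FY Ev; rewrite /endform_conj asboolT //.
  have Ei := bi_inv_mem t Ev.
  by rewrite h3 // bi_lin //; exact: endform_mem Hphi.
- move=> m a X u v FX Eu Ev; rewrite /endform_conj !asboolT //; last exact: subspaceP.
  have [Eiu Eiv] := (bi_inv_mem t Eu, bi_inv_mem t Ev).
  by rewrite bi_inv_lin // h4 // bi_lin //; exact: endform_mem Hphi.
- move=> X s sX ss; have [Es _] := ss.
  have -> : (fun m => endform_conj phi m (X m) (s m)) =
            (fun m => bi_fun t m (phi m (X m) (bi_inv t m (s m)))).
    by apply/funext => m; rewrite /endform_conj asboolT.
  by apply: bi_smooth; apply: h5 => //; exact: bi_inv_smooth.
Qed.

Lemma higgs_equations_conj D phi : is_pseudo_connection D ->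
  is_endform T10 E phi -> higgs_equations D phi ->
  higgs_equations (pc_conj D) (endform_conj phi).
Proof.
move=> [Df _ _] Hphi [Hflat Hhol Hwedge].
have Dm s m X : E m (D s m X) by exact: form_mem (Df _).
have Em (s : section E') m : E' m (s m) by have [] := svalP s.
have along_inv s X u : along (pc_conj D) s X u ->
    along D (section_inv s) X (section_inv u).
  by move=> su m; rewrite /= su /pc_conj bi_funK.
split.
- move=> X Y s sX sY hX hY aX aY m.
  have := Hflat _ _ _ _ _ hX hY (along_inv _ _ _ aX) (along_inv _ _ _ aY) m.
  move/(congr1 (bi_fun t m)); rewrite bi_fun0 !bi_funB //; exact: subspaceB.
- move=> X Y s sphi sY hX hY hs aY m Z Z' hZ hZ' e.
  have hs' x : section_inv sphi x = phi x (X x) (section_inv s x).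
    by rewrite /= hs /endform_conj asboolT // bi_funK //; exact: endform_mem Hphi.
  have := Hhol _ _ _ _ _ hX hY hs' (along_inv _ _ _ aY) m Z Z' hZ hZ' e.
  move/(congr1 (bi_fun t m)); rewrite bi_fun0.
  have Pm X' v : E m (phi m X' v) by exact: endform_mem Hphi.
  rewrite !bi_funB //; last exact: subspaceB.
  by rewrite /endform_conj !asboolT.
- move=> m X Y v hX hY Ev; have Ei := bi_inv_mem t Ev.
  have Pm X' w : E m (phi m X' w) by exact: endform_mem Hphi.
  have := Hwedge m X Y _ hX hY Ei; move/(congr1 (bi_fun t m)).
  rewrite bi_fun0 bi_funB // /endform_conj (asboolT Ev).
  by rewrite !asboolT ?bi_funK //; exact: bi_mem.
Qed.

Variables (B : pseudo_connection E) (B' : pseudo_connection E').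

Lemma pc_conj_subproof (D : pseudo_connection E) :
  pc_conj (pc_val D) \in [set D | @is_pseudo_connection E' D].
Proof. by apply/mem_set; apply: pc_conjP; exact: (set_mem (valP D)). Qed.

Definition connection_conj (D : pseudo_connection E) : pseudo_connection E' :=
  exist (fun D => D \in [set D | @is_pseudo_connection E' D]) _
    (pc_conj_subproof D).

Lemma endform_conj_subproof (phi : endforms T10 E) :
  (endform_conj (endform_val phi) : endform_space)
    \in [set eta : endform_space | is_endform T10 E' eta].
Proof. by apply/mem_set; apply: endform_conjP; exact: (set_mem (valP phi)). Qed.

Definition higgs_field_conj (phi : endforms T10 E) : endforms T10 E' :=
  exist (fun eta => eta \in [set eta : endform_space | is_endform T10 E' eta]) _
    (endform_conj_subproof phi).

Definition higgs_conn (x : higgs B) : pseudo_connection E := (set_val x).1.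
Definition higgs_field (x : higgs B) : endforms T10 E := (set_val x).2.

Lemma higgs_conj_subproof (x : higgs B) :
  (connection_conj (higgs_conn x) : based_connections B',
   higgs_field_conj (higgs_field x)) \in
    [set x : based_connections B' * endforms T10 E' |
      higgs_equations (pc_val x.1) (endform_val x.2)].
Proof.
apply/mem_set; apply: higgs_equations_conj; last exact: (set_mem (valP x)).
  exact: (set_mem (valP (higgs_conn x))).
exact: (set_mem (valP (higgs_field x))).
Qed.

Definition higgs_conj (x : higgs B) : higgs B' :=
  exist (fun x => x \in _) _ (higgs_conj_subproof x).

End Transport.

Lemma higgs_eq (E : bundle) (B : pseudo_connection E) (x y : higgs B) :
  (forall s m X, pc_val (higgs_conn x) s m X = pc_val (higgs_conn y) s m X) ->
  (forall m X v, endform_val (higgs_field x) m X v =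
                 endform_val (higgs_field y) m X v) -> x = y.
Proof.
move=> eD ephi; apply: val_inj; apply: injective_projections; apply: val_inj.
  by apply/funext => s; apply/funext => m; apply/funext => X; exact: eD.
by apply/funext => m; apply/funext => X; apply/funext => v; exact: ephi.
Qed.

Lemma higgs_conj_id (E : bundle) (B : pseudo_connection E)
    (t : bundle_iso E E) (x : higgs B) :
  (forall m v, E m v -> bi_fun t m v = v) -> higgs_conj t B x = x.
Proof.
move=> t1; have t1' m v : E m v -> bi_inv t m v = v.
  by move=> Ev; rewrite -{1}(t1 m v Ev) bi_funK.
apply: higgs_eq => [s m X|m X v] /=.
  have [Df _ _] : is_pseudo_connection (pc_val (higgs_conn x)) :=
    set_mem (valP (higgs_conn x)).
  rewrite -[LHS]/(bi_fun t m (pc_val (higgs_conn x) (section_inv t s) m X)).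
  rewrite t1; last exact: form_mem (Df _).
  congr (pc_val _ _ m X); apply: section_eq => y /=; apply: t1'.
  by have [] := svalP s.
have Hphi : is_endform T10 E (endform_val (higgs_field x)) :=
  set_mem (valP (higgs_field x)).
rewrite -[LHS]/(endform_conj t (endform_val (higgs_field x)) m X v) /endform_conj.
case: asboolP => [Ev|nEv]; first by rewrite t1' // t1 //; exact: endform_mem Hphi.
by have [_ -> //] := Hphi; move=> [].
Qed.

Lemma higgs_conn_conj (E E' : bundle) (t : bundle_iso E E')
    (B : pseudo_connection E) (B' : pseudo_connection E') (x : higgs B) :
  pc_val (higgs_conn (higgs_conj t B' x)) = pc_conj t (pc_val (higgs_conn x)).
Proof. by []. Qed.

Lemma higgs_field_conjE (E E' : bundle) (t : bundle_iso E E')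
    (B : pseudo_connection E) (B' : pseudo_connection E') (x : higgs B) :
  endform_val (higgs_field (higgs_conj t B' x)) =
  endform_conj t (endform_val (higgs_field x)).
Proof. by []. Qed.

Lemma higgs_conj_comp (E E' E'' : bundle) (B : pseudo_connection E)
    (B' : pseudo_connection E') (B'' : pseudo_connection E'')
    (u : bundle_iso E' E'') (t : bundle_iso E E') (x : higgs B) :
  higgs_conj u B'' (higgs_conj t B' x) = higgs_conj (bi_comp u t) B'' x.
Proof.
apply: higgs_eq => [s m X|m X v].
  have e : section_inv t (section_inv u s) = section_inv (bi_comp u t) s.
    exact: section_eq.
  by rewrite !higgs_conn_conj /pc_conj e.
rewrite !higgs_field_conjE /endform_conj; case: asboolP => // Ev.
by rewrite asboolT //; exact: bi_inv_mem.
Qed.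

Section Moduli.
Variables (E : bundle) (B : pseudo_connection E).

Definition gauge_rel (x y : higgs B) : bool :=
  `[< exists t : bundle_iso E E, y = higgs_conj t B x >].

Lemma gauge_refl : reflexive gauge_rel.
Proof. by move=> x; apply/asboolP; exists (bi_id E); rewrite higgs_conj_id. Qed.

Lemma gauge_sym : symmetric gauge_rel.
Proof.
have h x y : gauge_rel x y -> gauge_rel y x.
  move=> /asboolP[t ->]; apply/asboolP; exists (bi_sym t).
  by rewrite higgs_conj_comp higgs_conj_id // => m v Ev; exact: bi_funK.
by move=> x y; apply/idP/idP; exact: h.
Qed.

Lemma gauge_trans : transitive gauge_rel.
Proof.
move=> y x z /asboolP[t ->] /asboolP[u ->]; apply/asboolP.
by exists (bi_comp u t); rewrite higgs_conj_comp.
Qed.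

Canonical gauge_equiv := EquivRel gauge_rel gauge_refl gauge_sym gauge_trans.

Definition higgs_moduli := quotient_topology {eq_quot gauge_rel}.

Definition higgs_class (x : higgs B) : higgs_moduli := \pi_higgs_moduli x.

Lemma higgs_classP x y :
  higgs_class x = higgs_class y <-> exists t : bundle_iso E E, y = higgs_conj t B x.
Proof.
split=> [/eqmodP /asboolP //|h].
by apply/eqmodP/asboolP.
Qed.

End Moduli.

Definition moduli_map (E E' : bundle) (t : bundle_iso E E')
    (B : pseudo_connection E) (B' : pseudo_connection E')
    (q : higgs_moduli B) : higgs_moduli B' :=
  higgs_class (higgs_conj t B' (repr q)).

Lemma moduli_mapE (E E' : bundle) (t : bundle_iso E E')
    (B : pseudo_connection E) (B' : pseudo_connection E') (x : higgs B) :
  moduli_map t B' (higgs_class x) = higgs_class (higgs_conj t B' x).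
Proof.
have [u xE] : exists u : bundle_iso E E, x = higgs_conj u B (repr (higgs_class x)).
  by apply/higgs_classP; rewrite /higgs_class reprK.
rewrite /moduli_map; apply/higgs_classP; set r := repr _ in xE *.
exists (bi_comp t (bi_comp u (bi_sym t))).
have e : higgs_conj (bi_sym t) B (higgs_conj t B' r) = r.
  by rewrite higgs_conj_comp higgs_conj_id // => m v Ev; exact: bi_funK.
by rewrite -(higgs_conj_comp B) -(higgs_conj_comp B) e -xE.
Qed.

Lemma T10_subspace m : subspace_of (T10 m).
Proof.
split.
  do !split=> //.
  - by move=> a f g _ _; rewrite -[LHS]/(0 : C) -[RHS]/(a * 0 + 0) mulr0 addr0.
  - move=> f g _ _; rewrite -[LHS]/(0 : C) -[RHS]/(f m * 0 + 0 * g m).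
    by rewrite mulr0 mul0r addr0.
move=> a u v [[u0 ul um] uh] [[v0 vl vm] vh].
do !split.
- by move=> f nf; rewrite -[LHS]/(a * u f + v f) u0 // v0 // mulr0 addr0.
- move=> b f g sf sg; rewrite -[LHS]/(a * u _ + v _) ul // vl //.
  rewrite -[X in _ = b * X + _]/(a * u f + v f) -[X in _ = _ + X]/(a * u g + v g).
  by rewrite !mulrDr mulrCA !addrA [X in X + _ = _]addrAC.
- move=> f g sf sg; rewrite -[LHS]/(a * u _ + v _) um // vm //.
  rewrite -[X in _ = _ * X + _]/(a * u g + v g) -[X in _ = _ + X * _]/(a * u f + v f).
  by rewrite !mulrDr mulrDl mulrCA !addrA !mulrA [X in X + _ = _]addrAC.
- by move=> f sf hf; rewrite -[LHS]/(a * u f + v f) uh // vh // mulr0 addr0.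
Qed.

Definition pullback (h : M -> M) : bundle :=
  @Bundle (fun m => T10 (h m)) (fun m => T10_subspace (h m)).

Definition push (h : M -> M) (v : V) : V := fun f => v (f \o h).

Lemma smoothC_comp h f : smooth_map S S h -> smoothC f -> smoothC (f \o h).
Proof.
move=> [_ sh] [rf jf]; split.
  by have := sh setT _ openT rf; rewrite preimage_setT.
by have := sh setT _ openT jf; rewrite preimage_setT.
Qed.

Lemma push_T10 h k m v : cancel h k -> cancel k h -> holomorphic_map h ->
  holomorphic_map k -> T10 m v -> T10 (h m) (push h v).
Proof.
move=> hK kH [sh hh] [sk _] [[v0 vl vm] va].
have sC f : smoothC f -> smoothC (f \o h) by exact: smoothC_comp.
do !split.
- move=> f nf; apply: v0 => sf; apply: nf.
  have -> : f = (f \o h) \o k by apply/funext => x /=; rewrite kH.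
  exact: smoothC_comp.
- by move=> a f g sf sg; rewrite /push -vl //; exact: sC.
- by move=> f g sf sg; rewrite /push -vm //; exact: sC.
- move=> f sf [U [oU Um hU]]; apply: va; first exact: sC.
  exists (h @^-1` U); split=> //.
    by case: sh => /continuousP ch _; exact: ch.
  exact: hh hU.
Qed.

Lemma push_section h k a b s : cancel h k -> cancel k h -> holomorphic_map h ->
  holomorphic_map k -> b =1 h \o a ->
  smooth_section (pullback a) s -> smooth_section (pullback b) (fun m => push h (s m)).
Proof.
move=> hK kH hh hk ba [Es ss]; split=> [m|f sf].
  by rewrite /= ba; exact: push_T10 (Es m).
by apply: ss; case: hh => sh _; exact: smoothC_comp.
Qed.

Definition push_iso (a b h k : M -> M) (hK : cancel h k) (kH : cancel k h)
    (hh : holomorphic_map h) (hk : holomorphic_map k) (ba : b =1 h \o a) :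
  bundle_iso (pullback a) (pullback b).
Proof.
have ab : a =1 k \o b by move=> m /=; rewrite ba /= hK.
apply: (@BundleIso _ _ (fun _ => push h) (fun _ => push k)).
- by move=> m v Tv; rewrite /= ba; exact: push_T10 Tv.
- by move=> m v Tv; rewrite /= ab; exact: push_T10 Tv.
- by [].
- by [].
- move=> m v _; apply/funext => f; rewrite /push; congr v.
  by apply/funext => x /=; rewrite hK.
- move=> m v _; apply/funext => f; rewrite /push; congr v.
  by apply/funext => x /=; rewrite kH.
- by move=> s; exact: push_section.
- by move=> s; exact: push_section.
Defined.

Record holomorphic_action (Lam : groupType) := HolomorphicAction {
  ha_act :> Lam -> M -> M;
  ha_act1 : forall m, ha_act 1%g m = m;
  ha_actM : forall g h m, ha_act (g * h)%g m = ha_act g (ha_act h m);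
  ha_hol : forall g, biholomorphism (ha_act g) }.

Section Coproduct.
Variables (Lam : groupType) (act : holomorphic_action Lam).

Lemma ha_K g : cancel (act g) (act g^-1%g).
Proof. by move=> m; rewrite -ha_actM mulVg ha_act1. Qed.

Lemma ha_VK g : cancel (act g^-1%g) (act g).
Proof. by move=> m; rewrite -ha_actM mulgV ha_act1. Qed.

Lemma ha_holomorphic g : holomorphic_map (act g).
Proof. by have [k []] := ha_hol act g. Qed.

(* E^g is [pullback (act g)]; this is g : E^h -> E^(gh). *)
Definition translate (g h : Lam) :
    bundle_iso (pullback (act h)) (pullback (act (g * h)%g)) :=
  push_iso (ha_K g) (ha_VK g) (ha_holomorphic g) (ha_holomorphic g^-1%g)
    (ha_actM act g h).

Definition translate1 (g : Lam) :
    bundle_iso (pullback id) (pullback (act g)) :=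
  push_iso (ha_K g) (ha_VK g) (ha_holomorphic g) (ha_holomorphic g^-1%g)
    (fun=> erefl).

Variable D0 : pseudo_connection (pullback id).

Definition base_connection (g : Lam) : pseudo_connection (pullback (act g)) :=
  connection_conj (translate1 g) D0.

Definition higgs_coproduct : topologicalType :=
  {g : Lam & higgs_moduli (base_connection g)}.

Definition higgs_coproduct_act (g : Lam) (p : higgs_coproduct) :
    higgs_coproduct :=
  existT _ (g * projT1 p)%g
    (moduli_map (translate g (projT1 p)) (base_connection (g * projT1 p)%g)
       (projT2 p)).

End Coproduct.

End HiggsBundles.

Definition dod_holomorphic_action (R : realType) (Gam : groupType)
    (G : lieGroup R) (rho : Multiplicative.type Gam G) (H : subgroup G)
    (Om : domain_of_discontinuity rho H) (J : complex_curve (dod_structure Om))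
    (hol : forall g : image_group rho, biholomorphism J (@dod_act R Gam G rho H Om g)) :
    holomorphic_action J (image_group rho) :=
  HolomorphicAction (@dod_act1 R Gam G rho H Om) (@dod_actM R Gam G rho H Om) hol.

Definition properly_discontinuous (Gam : Type) (T : topologicalType)
    (act : Gam -> T -> T) : Prop :=
  forall K : set T, compact K -> finite_set [set g | (act g @` K) `&` K !=set0].

(* Main.v *)
(* The index of a component of the coproduct is multiplied on the left by rho g.
   A compact set meets only finitely many components, so only finitely many
   elements of rho(Gam) can move it to meet itself; and rho has finite kernel, as
   the kernel fixes a point of the domain of discontinuity. *)

Require Import Defs.
From HB Require Import structures.
From mathcomp Require Import all_boot all_order all_algebra.
From mathcomp Require Import all_classical all_reals all_analysis.
Import Order.TTheory GRing.Theory Num.Theory.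
Local Open Scope classical_set_scope.
Local Open Scope ring_scope.

(** The components are open and disjoint, so finitely many of them cover a compact set. Compactness
    enters in its near-covering form. *)
Lemma compact_sigT_finite (I : choiceType) (T : I -> topologicalType)
    (K : set {i : I & T i}) :
  compact K -> finite_set [set projT1 p | p in K].
Proof.
move=> /compact_near_coveringP Kcov.
(* Convergence along the finite sets of indices directed by inclusion: eventually means for all
   finite sets above some finite [A]. *)
pose F : set_system (set I) :=
  filter_from finite_set (fun A => [set B | finite_set B /\ A `<=` B]).
have FF : Filter F.
  apply: filter_from_filter => [|A A' finA finA'].
    by exists set0; exact: finite_set0.
  exists (A `|` A') => [|B [finB]].
    by rewrite finite_setU.
  by rewrite subUset => -[AB A'B].
have [p Kp|A finA sub] := Kcov _ F (fun B p => B (projT1 p)) FF.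
  (* The index is constant on the component of [p], and every finite [B] above its singleton
     contains it. *)
  exists ([set q | projT1 q = projT1 p],
          [set B | finite_set B /\ [set projT1 p] `<=` B]).
    split; last by exists [set projT1 p] => //; exact: finite_set1.
    case: p {Kp} => i x; rewrite /= /nbhs /= sigT_nbhsE.
    by apply: filterS (@filterT _ (nbhs x) _).
  by move=> [q B] /= [qp [_]]; rewrite qp; apply.
(* [A] is itself one of the finite sets above [A]. *)
have KA : K `<=` (fun p => A (projT1 p))
  by apply: (sub A); split.
by apply: sub_finite_set finA => _ [p Kp <-]; exact: KA.
Qed.

(** Each fibre of [rho] is empty or a left coset of the kernel. *)
Lemma finite_preimage_morphism (Gam G : groupType)
    (rho : Multiplicative.type Gam G) (A : set G) :
  finite_set [set g | rho g = 1%g] -> finite_set A -> finite_set (rho @^-1` A).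
Proof.
move=> fin_ker finA.
have -> : rho @^-1` A = \bigcup_(y in A) (rho @^-1` [set y]).
  by apply/seteqP; split=> [g Ag|g [y Ay /= ->]] //; exists (rho g).
apply: bigcup_finite => // y _.
have [[h hy]|no] := pselect (exists h, rho h = y); last first.
  by rewrite (_ : _ @^-1` _ = set0) // -subset0 => g gy; apply: no; exists g.
apply: sub_finite_set (finite_image (fun k => h * k)%g fin_ker) => g /= gy.
exists (h^-1 * g)%g; last by rewrite mulVKg.
by apply: (mulgI (rho h)); rewrite -gmulfM mulVKg mulg1 gy hy.
Qed.

Lemma dod_finite_ker (R : realType) (Gam : groupType) (G : lieGroup R)
    (rho : Gam -> G) (H : subgroup G) (Om : domain_of_discontinuity rho H) :
  dod Om !=set0 -> finite_set [set g | rho g = 1%g].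
Proof.
move=> [x Ox].
have xOm : [set x] `<=` dod Om by move=> _ ->.
(* With the compact set [[set x]], the finite set obtained is the stabilizer of [x]. *)
have := dod_proper (@compact_set1 (coset_space H) x) xOm.
apply: sub_finite_set => g /= g1.
by exists x; split=> //; exists x; rewrite // g1 coset_act1.
Qed.

Theorem corollary5p1
    (R : realType)
    (Gam : groupType) (S : genset Gam) (hGam : word_hyperbolic S R)
    (X : flow_space R S)
    (G : lieGroup R) (hG : semisimple_lie_group G)
    (Pplus Pminus : subgroup G)
    (hP : opposite_parabolic_subgroups Pplus Pminus)
    (rho : Multiplicative.type Gam G)
    (hrho : anosov X rho Pplus Pminus)
    (H : subgroup G) (hH : parabolic_subgroup H \/ symmetric_subgroup H)
    (Om : domain_of_discontinuity rho H) (hOm : dod Om !=set0)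
    (J : complex_curve (dod_structure Om))
    (hol : forall g : image_group rho, biholomorphism J (dod_act (Om := Om) g))
    (D0 : pseudo_connection J (pullback J id)) :
  properly_discontinuous
    (fun g : Gam =>
       higgs_coproduct_act (act := dod_holomorphic_action hol) (D0 := D0)
         (in_image rho g)).
Proof.
move=> K cK; have finI := compact_sigT_finite _ _ _ cK.
set I := [set projT1 p | p in K] in finI.
(* If [g] moves a point of [K] of index [b] to a point of [K] of index [a], then [rho g * b = a], so
   [rho g] is one of these finitely many quotients. *)
have finM := finite_image2 (fun a b => image_val a * (image_val b)^-1)%g finI finI.
have := finite_preimage_morphism _ _ _ _ (dod_finite_ker _ _ _ _ _ _ hOm) finM.
apply: sub_finite_set => g [_ [[p Kp <-] Kgp]] /=.
exists (in_image rho g * projT1 p)%g.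
  by exists (higgs_coproduct_act (in_image rho g) p).
exists (projT1 p); first by exists p.
by rewrite image_valM mulgK.
Qed.
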